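(* Let $\mathcal{X}\subset\mathbb{R}^d$ be compact, $k$ a positive definite kernel with $k(x,x)\le 1$, and $f\in\mathcal{H}_k$. Let $T=NL$. Assume all kernel matrices of the queried points are invertible and all maximizers below exist. Run Algorithm 2: for $n=1,\dots,N$, choose the batch $X_n=(x_{(n-1)L+1},\dots,x_{nL})$ as a maximizer over $X=(z_1,\dots,z_L)\in\mathcal{X}^L$ of $$\frac1L\sum_{i=1}^L m_{(n-1)L}(z_i)+\|f\|_{\mathcal{H}_k}\left(2\sqrt{\frac{\operatorname{tr}(\operatorname{cov}_{n-1}(X,X))}{L}}-\sqrt{\frac{\mathbf{1}^T\operatorname{cov}_{n-1}(X,X)\mathbf{1}}{L^2}}\right),$$ then observe $f$ at all points of $X_n$. Fix $\sigma>0$, let $\beta=\max_{n\in\{1,\dots,N\}}\|\widehat{\operatorname{cov}}_{n-1}(X_n,X_n)\|_2$ (spectral norm), assume $\beta>0$, and let $C_2=\frac{8\beta}{\log(1+\beta\sigma^{-2})}$. Then $$R_T\le\|f\|_{\mathcal{H}_k}\sqrt{TC_2\gamma_T},\qquad r_T\le\|f\|_{\mathcal{H}_k}\sqrt{\frac{C_2\gamma_T}{T}}.$$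
   Context: For query points $x_1,\dots,x_t$: $\mathbf{k}_t(x)=[k(x,x_1),\dots,k(x,x_t)]^T$, $\mathbf{K}_t=[k(x_i,x_j)]_{i,j\le t}$, $\mathbf{f}_t=[f(x_i)]_{i\le t}$, $m_t(x)=\mathbf{k}_t(x)^T\mathbf{K}_t^{-1}\mathbf{f}_t$ ($m_0\equiv0$). $\overline X_n=\{x_1,\dots,x_{nL}\}$ denotes all points of the first $n$ batches. For an $L$-tuple $X$, $\mathbf{K}(X,X)$ is the $L\times L$ kernel matrix and $\mathbf{K}(\overline X_n,X)$ the $nL\times L$ cross kernel matrix; $\operatorname{cov}_n(X,X)=\mathbf{K}(X,X)-\mathbf{K}(\overline X_n,X)^T\mathbf{K}(\overline X_n,\overline X_n)^{-1}\mathbf{K}(\overline X_n,X)$ and $\widehat{\operatorname{cov}}_n(X,X)=\mathbf{K}(X,X)-\mathbf{K}(\overline X_n,X)^T(\sigma^2I+\mathbf{K}(\overline X_n,\overline X_n))^{-1}\mathbf{K}(\overline X_n,X)$, with $\operatorname{cov}_0=\widehat{\operatorname{cov}}_0=\mathbf{K}(X,X)$. $x^*\in\arg\max_{\mathcal{X}}f$, $R_T=\sum_{t=1}^T(f(x^* )-f(x_t))$, $r_T=f(x^* )-\max_{t\le T}f(x_t)$, $\gamma_T=\max_{x_1,\dots,x_T\in\mathcal{X}}\frac12\log\det(\mathbf{I}_T+\sigma^{-2}\mathbf{K}_T)$. *)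

(* Defs.v *)
From Stdlib Require Import Reals Lra Lia Arith.
From Stdlib Require Vectors.Fin.
Open Scope R_scope.

Definition Rd (d : nat) : Type := Fin.t d -> R.

Fixpoint sumR (n : nat) (F : nat -> R) : R :=
  match n with O => 0 | S m => sumR m F + F m end.

Fixpoint maxR (n : nat) (s : nat -> R) : R :=
  match n with O => s O | S m => Rmax (maxR m s) (s (S m)) end.

(* Matrices are functions nat -> nat -> R; only indices < size matter. *)
Definition minor (A : nat -> nat -> R) (i j : nat) : nat -> nat -> R :=
  fun a b => A (if (a <? i)%nat then a else S a) (if (b <? j)%nat then b else S b).

Fixpoint det (n : nat) (A : nat -> nat -> R) : R :=
  match n with
  | O => 1
  | S m => sumR (S m) (fun j => (-1) ^ j * A O j * det m (minor A O j))
  end.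

(* Inverse via the adjugate: A^{-1}_{ij} = (-1)^{i+j} det(minor A j i) / det A. *)
Definition minv (n : nat) (A : nat -> nat -> R) : nat -> nat -> R :=
  fun i j => (-1) ^ (i + j) * det (n - 1) (minor A j i) / det n A.

Definition idm (i j : nat) : R := if (i =? j)%nat then 1 else 0.

Definition vnorm (n : nat) (v : nat -> R) : R := sqrt (sumR n (fun i => v i ^ 2)).
Definition matvec (n : nat) (A : nat -> nat -> R) (v : nat -> R) : nat -> R :=
  fun i => sumR n (fun j => A i j * v j).
Definition is_spec_norm (n : nat) (A : nat -> nat -> R) (s : R) : Prop :=
  is_lub (fun r => exists v, vnorm n v = 1 /\ r = vnorm n (matvec n A v)) s.

(* Compactness of X ⊂ R^d (sequential compactness, coordinatewise = Euclidean
   convergence in finite dimension). *)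
Definition compact_Rd {d : nat} (X : Rd d -> Prop) : Prop :=
  forall u : nat -> Rd d, (forall n, X (u n)) ->
    exists (phi : nat -> nat) (l : Rd d),
      (forall n, (phi n < phi (S n))%nat) /\ X l /\
      forall i, Un_cv (fun n => u (phi n) i) (l i).

Definition pd_kernel {d : nat} (X : Rd d -> Prop) (k : Rd d -> Rd d -> R) : Prop :=
  (forall x y, X x -> X y -> k x y = k y x) /\
  (forall (n : nat) (c : nat -> R) (p : nat -> Rd d),
     (forall i, (i < n)%nat -> X (p i)) ->
     0 <= sumR n (fun i => sumR n (fun j => c i * c j * k (p i) (p j)))).

(* Pre-RKHS elements: finite combinations sum_{i<h_n} h_c i * k(h_p i, .) *)
Record H0 (d : nat) := mkH0 { h_n : nat; h_c : nat -> R; h_p : nat -> Rd d }.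
Arguments h_n {d}. Arguments h_c {d}. Arguments h_p {d}. Arguments mkH0 {d}.

Definition h0_eval {d} (k : Rd d -> Rd d -> R) (g : H0 d) (x : Rd d) : R :=
  sumR (h_n g) (fun i => h_c g i * k (h_p g i) x).
Definition h0_norm {d} (k : Rd d -> Rd d -> R) (g : H0 d) : R :=
  sqrt (sumR (h_n g) (fun i => sumR (h_n g) (fun j =>
          h_c g i * h_c g j * k (h_p g i) (h_p g j)))).
Definition h0_sub {d} (g1 g2 : H0 d) : H0 d :=
  mkH0 (h_n g1 + h_n g2)
       (fun i => if (i <? h_n g1)%nat then h_c g1 i else - h_c g2 (i - h_n g1))
       (fun i => if (i <? h_n g1)%nat then h_p g1 i else h_p g2 (i - h_n g1)).

(* Moore–Aronszajn: f ∈ H_k with ||f||_{H_k} = B iff f is the pointwise limit on X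
   of a Cauchy sequence (g_n) in the pre-RKHS, and B = lim ||g_n||. *)
Definition rkhs_limit {d} (X : Rd d -> Prop) (k : Rd d -> Rd d -> R)
    (f : Rd d -> R) (g : nat -> H0 d) (B : R) : Prop :=
  (forall n i, (i < h_n (g n))%nat -> X (h_p (g n) i)) /\
  (forall eps, 0 < eps -> exists M, forall m n, (M <= m)%nat -> (M <= n)%nat ->
       h0_norm k (h0_sub (g m) (g n)) < eps) /\
  (forall x, X x -> Un_cv (fun n => h0_eval k (g n) x) (f x)) /\
  Un_cv (fun n => h0_norm k (g n)) B.

Definition Kmat {d} (k : Rd d -> Rd d -> R) (x : nat -> Rd d) : nat -> nat -> R :=
  fun i j => k (x i) (x j).

Definition post_mean {d} (k : Rd d -> Rd d -> R) (x : nat -> Rd d) (f : Rd d -> R)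
    (t : nat) (z : Rd d) : R :=
  sumR t (fun i => sumR t (fun j => k z (x i) * minv t (Kmat k x) i j * f (x j))).

(* cov_n(Z,Z) with t = nL conditioning points *)
Definition cov {d} (k : Rd d -> Rd d -> R) (x : nat -> Rd d) (t : nat)
    (Z : nat -> Rd d) : nat -> nat -> R :=
  fun a b => k (Z a) (Z b) -
    sumR t (fun i => sumR t (fun j => k (x i) (Z a) * minv t (Kmat k x) i j * k (x j) (Z b))).

(* hat-cov_n(Z,Z) with noise variance s2 = sigma^2 *)
Definition hatcov {d} (k : Rd d -> Rd d -> R) (x : nat -> Rd d) (s2 : R) (t : nat)
    (Z : nat -> Rd d) : nat -> nat -> R :=
  fun a b => k (Z a) (Z b) -
    sumR t (fun i => sumR t (fun j => k (x i) (Z a) *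
       minv t (fun i' j' => s2 * idm i' j' + Kmat k x i' j') i j * k (x j) (Z b))).

(* Acquisition function of Algorithm 2 for batch n (0-based), candidate batch Z
   (Z 0, ..., Z (L-1)); conditioning on the first nL points. B = ||f||_{H_k}. *)
Definition acq {d} (k : Rd d -> Rd d -> R) (f : Rd d -> R) (x : nat -> Rd d)
    (B : R) (L n : nat) (Z : nat -> Rd d) : R :=
  let C := cov k x (n * L) Z in
  / INR L * sumR L (fun i => post_mean k x f (n * L) (Z i)) +
  B * (2 * sqrt (sumR L (fun a => C a a) / INR L)
       - sqrt (sumR L (fun a => sumR L (fun b => C a b)) / (INR L ^ 2))).

Definition gamma_set {d} (X : Rd d -> Prop) (k : Rd d -> Rd d -> R) (sigma : R)
    (T : nat) : R -> Prop :=
  fun g => exists p : nat -> Rd d, (forall t, (t < T)%nat -> X (p t)) /\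
    g = / 2 * ln (det T (fun i j => idm i j + / sigma ^ 2 * k (p i) (p j))).

(* Main.v *)
(* Write P_n for the orthogonal projection of H_k onto the span of the kernel
   sections at the first nL points.  For weights v on a batch Z,
   sum_a v_a (f - m)(z_a) = <f, (1 - P_n) sum_a v_a k(z_a, .)> is at most
   ||f|| sqrt(v^T cov_n v).  Comparing the chosen batch with the constant batch
   (xstar, ..., xstar), where the two square roots of the acquisition function agree,
   and using this bound for the average over the chosen batch, the terms in
   1^T cov 1 cancel and leave a batch regret of at most 2 ||f|| sqrt(L tr cov_n).
   Next tr cov_n <= tr hatcov_n, and as the eigenvalues of hatcov_n lie in
   [0, beta], concavity of the logarithm gives
   tr hatcov_n <= beta / log(1 + beta/sigma^2) * log det(I + sigma^-2 hatcov_n).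
   By Schur complements these determinants multiply to det(I + sigma^-2 K_T),
   and Cauchy-Schwarz over the batches concludes. *)
Require Import Defs.
From Stdlib Require Import Reals Lra Lia Arith.
From mathcomp Require all_boot all_order all_algebra spectral complex Rstruct.
Open Scope R_scope.

Module KernelMatrix.
Import all_boot all_order all_algebra spectral complex Rstruct.
Import Order.TTheory GRing.Theory Num.Theory.
Set Implicit Arguments.
Unset Strict Implicit.
Local Open Scope ring_scope.

(** * Symmetric matrices *)

Definition quad (F : pzRingType) n (A : 'M[F]_n) (v : 'rV[F]_n) : F :=
  (v *m A *m v^T) 0 0.

(** Block LU factorisation: the left factor is unit lower triangular, the right one is block upper
    triangular with the Schur complement in its corner. *)
Lemma det_schur (F : fieldType) m n (A : 'M[F]_m) B C (D : 'M[F]_n) :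
  A \in unitmx ->
  \det (block_mx A B C D) = \det A * \det (D - C *m invmx A *m B).
Proof.
move=> uA.
have -> : block_mx A B C D =
    block_mx 1%:M 0 (C *m invmx A) 1%:M *m
    block_mx A B 0 (D - C *m invmx A *m B).
  rewrite mulmx_block !mul1mx !mul0mx !addr0 mulmxKV //.
  by rewrite addrCA subrr addr0.
by rewrite det_mulmx det_lblock det_ublock !det1 !mul1r.
Qed.

(** The weights [- (v *m C *m invmx A)] on the first block cancel the first block column, so only
    the last column paired with [v] survives. *)
Lemma quad_schur (F : fieldType) m n (A : 'M[F]_m) (B : 'M_(m, n)) C D v :
  A \in unitmx ->
  quad (D - C *m invmx A *m B) v =
  quad (block_mx A B C D) (row_mx (- (v *m C *m invmx A)) v).
Proof.
move=> uA; rewrite /quad mul_row_block !mulNmx mulmxKV // addNr.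
rewrite tr_row_mx mul_row_col mul0mx add0r.
by congr ((_ *m _) _ _); rewrite mulmxBr addrC !mulmxA.
Qed.

Lemma quadE (F : comPzRingType) n (A : 'M[F]_n) v :
  quad A v = \sum_i \sum_j v 0 i * v 0 j * A i j.
Proof.
rewrite /quad !mxE exchange_big /=; apply: eq_bigr => j _.
rewrite !mxE mulr_suml; apply: eq_bigr => i _.
by rewrite mulrAC.
Qed.

Lemma quadD (F : pzRingType) n (A B : 'M[F]_n) v :
  quad (A + B) v = quad A v + quad B v.
Proof. by rewrite /quad mulmxDr mulmxDl mxE. Qed.

Lemma quad_scalar (F : comPzRingType) n (s : F) (v : 'rV[F]_n) :
  quad s%:M v = s * \sum_i v 0 i ^+ 2.
Proof.
rewrite /quad mul_mx_scalar -scalemxAl mxE; congr (_ * _).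
by rewrite mxE; apply: eq_bigr => i _; rewrite mxE expr2.
Qed.

Lemma sqr_sum_ge0 (F : realDomainType) n (v : 'rV[F]_n) :
  0 <= \sum_i v 0 i ^+ 2.
Proof. by apply: sumr_ge0 => i _; rewrite sqr_ge0. Qed.

(** If v (s + K) = 0, then [quad K v] + s |v|^2 = 0 with both terms nonnegative; as s > 0, v = 0. *)
Lemma unitmx_shift (F : realFieldType) n (s : F) (K : 'M[F]_n) :
  (forall v, 0 <= quad K v) -> 0 < s -> s%:M + K \in unitmx.
Proof.
move=> pK s0; rewrite -row_free_unit; apply: inj_row_free => v v0.
have: quad (s%:M + K) v = 0 by rewrite /quad v0 mul0mx mxE.
rewrite quadD quad_scalar => /eqP.
rewrite paddr_eq0 ?mulr_ge0 ?sqr_sum_ge0 ?(ltW s0) //.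
case/andP; rewrite mulf_eq0 gt_eqF //= psumr_eq0 => [/allP h _|i _]; last first.
  exact: sqr_ge0.
apply/rowP => i; rewrite mxE; apply/eqP; rewrite -sqrf_eq0.
by apply: h; rewrite mem_index_enum.
Qed.

Lemma quad_invmx (F : fieldType) n (K : 'M[F]_n) c :
  K^T = K -> K \in unitmx -> quad (invmx K) c = quad K (c *m invmx K).
Proof.
move=> sK uK.
by rewrite /quad trmx_mul trmx_inv sK !mulmxA mulmxKV.
Qed.

Lemma quad_invmx_shift (F : realFieldType) n (s : F) (K : 'M[F]_n) c :
  K^T = K -> (forall v, 0 <= quad K v) -> K \in unitmx -> 0 <= s ->
  s%:M + K \in unitmx -> quad (invmx (s%:M + K)) c <= quad (invmx K) c.
Proof.
move=> sK pK uK s0 uKs.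
(* With u = c (s + K)^-1 the two sides differ by s (|u|^2 + s u K^-1 u^T). *)
have [u uE] : {u | c *m invmx (s%:M + K) = u} by exists (c *m invmx (s%:M + K)).
have [w wE] : {w | c *m invmx K = w} by exists (c *m invmx K).
have uK' : u *m (s%:M + K) = c by rewrite -uE mulmxKV.
have wu : w = u + s *: (u *m invmx K).
  rewrite -wE -uK' mulmxDr mulmxDl mulmxK // mul_mx_scalar addrC.
  by rewrite -scalemxAl.
have -> : quad (invmx K) c =
  quad (invmx (s%:M + K)) c + s * ((u *m u^T) 0 0 + s * quad (invmx K) u).
  rewrite /quad uE wE [in LHS]wu mulmxDl -scalemxAl.
  have -> : u *m invmx K *m c^T = u *m w^T.
    by rewrite -mulmxA -wE trmx_mul trmx_inv sK.
  have -> : u *m w^T = u *m u^T + s *: (u *m invmx K *m u^T).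
    by rewrite wu linearD linearZ /= mulmxDr -scalemxAr trmx_mul trmx_inv sK mulmxA.
  have e (x y z : 'M[F]_1) :
    (x + s *: (y + s *: z)) 0 0 = x 0 0 + s * (y 0 0 + s * z 0 0).
    by rewrite !mxE.
  by rewrite e /quad.
rewrite lerDl mulr_ge0 // addr_ge0 //.
  rewrite mxE; apply: sumr_ge0 => i _; rewrite mxE.
  by rewrite -expr2 sqr_ge0.
by rewrite mulr_ge0 // quad_invmx.
Qed.

(** A real symmetric matrix is normal over [F[i]], hence unitarily diagonalisable there. Each
    eigenvalue is a sum of two values of the real form of [A], and trace and determinant descend
    along the injection of [F] into [F[i]]. *)
Lemma spectral_bounds (F : rcfType) n (A : 'M[F]_n) (b : F) :
  A^T = A -> (forall v, 0 <= quad A v) ->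
  (forall v, quad A v <= b * \sum_i v 0 i ^+ 2) ->
  exists l : 'rV[F]_n, [/\ forall i, 0 <= l 0 i <= b, \tr A = \sum_i l 0 i &
    forall c, \det (1%:M + c *: A) = \prod_i (1 + c * l 0 i)].
Proof.
move=> sA pA bA.
pose toC : {rmorphism F -> F[i]} := real_complex F; pose Ac := map_mx toC A.
have hA : Ac \is normalmx.
  apply/normalmxP; have -> : (map_mx Num.conj_op Ac^T) = Ac => //.
  rewrite map_trmx; apply/matrixP => i j; rewrite !mxE /=.
  by rewrite [LHS]conjc_real -[in LHS]sA mxE.
have := orthomx_spectralP hA.
set P := spectralmx Ac; set D := spectral_diag Ac => AE.
have uP : P \is unitarymx := spectral_unitarymx Ac.
have UP : P \in unitmx := unitarymx_unit uP.
have DP : diag_mx D = P *m Ac *m (map_mx Num.conj_op P^T).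
  rewrite AE !mulmxA mulmxV // mul1mx.
  by rewrite -invmx_unitary // -mulmxA mulmxV // mulmx1.
(* If r + i m is the i-th row of the unitary P, then symmetry of A makes the i-th
   eigenvalue equal to r A r^T + m A m^T, where |r|^2 + |m|^2 = 1. *)
pose r i : 'rV[F]_n := \row_j complex.Re (P i j).
pose m i : 'rV[F]_n := \row_j complex.Im (P i j).
have rowP i : row i P = map_mx toC (r i) + 'i%C *: map_mx toC (m i).
  by apply/rowP => j; rewrite !mxE -complexE.
have rowPc i : map_mx Num.conj_op (row i P)^T =
    map_mx toC (r i)^T - 'i%C *: map_mx toC (m i)^T.
  apply/colP => j; rewrite !mxE /=; case: (P i j) => a c.
  by simpc.
have formE i (M : 'M[F]_n) : M^T = M ->
    (row i P *m map_mx toC M *m map_mx Num.conj_op (row i P)^T) 0 0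
    = toC (quad M (r i) + quad M (m i)).
  move=> sM; rewrite rowPc rowP !mulmxDl !mulmxDr -!scalemxAl -!map_mxM.
  rewrite !mulmxN -!scalemxAr -!map_mxM.
  (* The two cross terms are transposes of each other as 1 by 1 matrices, so the imaginary part
     vanishes. *)
  have e : r i *m M *m (m i)^T = m i *m M *m (r i)^T.
    transitivity (r i *m M *m (m i)^T)^T; last by rewrite !trmx_mul trmxK sM mulmxA.
    by apply/matrixP => a c; rewrite !ord1 [RHS]mxE.
  rewrite e scalerN scalerA -expr2 sqr_i scaleN1r opprK addrA subrK.
  by rewrite -map_mxD mxE [in LHS]mxE.
have DE i : D 0 i = toC (quad A (r i) + quad A (m i)).
  rewrite -formE //; have /(congr1 (fun M : 'M_n => M i i)) := DP.
  rewrite mxE eqxx mulr1n => ->; rewrite -row_mul !mxE.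
  by apply: eq_bigr => j _; rewrite !mxE.
(* This is [formE] at the identity matrix, since the rows of the unitary [P] have norm 1. *)
have normE i : \sum_j r i 0 j ^+ 2 + \sum_j m i 0 j ^+ 2 = 1.
  apply: (@complexI F); rewrite -[X in real_complex F (X + _)]mul1r.
  rewrite -[X in real_complex F (_ + X)]mul1r -!quad_scalar.
  rewrite -[LHS]formE ?tr_scalar_mx // map_mx1 mulmx1.
  have /unitarymxP/(congr1 (fun M : 'M_n => M i i)) := uP.
  rewrite [X in _ = X -> _]mxE eqxx mulr1n (rmorph1 toC) => <-; rewrite !mxE.
  by apply: eq_bigr => j _; rewrite !mxE.
exists (\row_i (quad A (r i) + quad A (m i))); split.
- move=> i; rewrite mxE addr_ge0 ?pA //=.
  by rewrite -[b]mulr1 -(normE i) mulrDr lerD ?bA.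
- apply: (@complexI F); rewrite -[LHS](trace_map_mx toC) -/Ac AE.
  rewrite mxtrace_mulC mulmxA mulmxV // mul1mx mxtrace_diag.
  rewrite [RHS](rmorph_sum toC).
  by apply: eq_bigr => i _; rewrite mxE DE.
move=> c; apply: (@complexI F); rewrite -[LHS](det_map_mx toC).
rewrite map_mxD map_mx1 map_mxZ -/Ac AE.
(* The matrix is similar to a diagonal one, and the similarity drops out of the determinant. *)
have -> : 1%:M + toC c *: (invmx P *m diag_mx D *m P) =
   invmx P *m (1%:M + toC c *: diag_mx D) *m P.
  by rewrite mulmxDr mulmxDl mulmx1 mulVmx // -scalemxAr -scalemxAl.
rewrite !det_mulmx mulrAC -det_mulmx mulVmx // det1 mul1r.
have -> : 1%:M + toC c *: diag_mx D = diag_mx (\row_i (1 + toC c * D 0 i)).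
  apply/matrixP => i j; rewrite !mxE; case: eqP => _; first by rewrite !mulr1n.
  by rewrite !mulr0n mulr0 addr0.
rewrite det_diag [RHS](rmorph_prod toC); apply: eq_bigr => i _.
by rewrite !mxE DE [RHS](rmorphD toC) [X in _ = _ + X](rmorphM toC) (rmorph1 toC).
Qed.

(** * Kernel matrices and posterior covariances *)

Definition mx m n (A : nat -> nat -> R) : 'M[R]_(m, n) := \matrix_(i, j) A i j.

Lemma sumRE n F : sumR n F = \sum_(i < n) F i.
Proof.
by elim: n => [|n IH]; rewrite ?big_ord0 // big_ord_recr /= IH RplusE.
Qed.

Lemma ltbE a b : Nat.ltb a b = (a < b)%N.
Proof. by apply/idP/idP => [/Nat.ltb_lt/ssrnat.ltP|/ssrnat.ltP/Nat.ltb_lt]. Qed.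

Lemma minor_bump A i j a b : minor A i j a b = A (bump i a) (bump j b).
Proof.
rewrite /minor !ltbE /bump.
by case: ssrnat.ltnP => _; case: ssrnat.ltnP => _; rewrite ?add0n ?add1n.
Qed.

Lemma mx_minor n A (i j : 'I_n.+1) :
  mx n n (minor A i j) = row' i (col' j (mx n.+1 n.+1 A)).
Proof. by apply/matrixP => a b; rewrite !mxE minor_bump. Qed.

(** Both sides obey Laplace expansion along row 0. *)
Lemma detE n A : det n A = \det (mx n n A).
Proof.
elim: n A => [|n IH] A; first by rewrite det_mx00.
rewrite (expand_det_row _ ord0) /det -/det sumRE; apply: eq_bigr => j _.
rewrite IH (mx_minor _ ord0 j) mxE /cofactor add0n !RmultE RpowE.
by rewrite mulrCA mulrA.
Qed.

(** Singular matrices have to be excluded: on them [invmx] returns its argument, while [minv]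
    divides by zero. *)
Lemma minvE n A (i j : 'I_n) :
  det n A <> 0 -> minv n A i j = invmx (mx n n A) i j.
Proof.
case: n i j => [|n] i j; first by case: i.
move=> d0; have -> : invmx (mx n.+1 n.+1 A) =
    (det n.+1 A)^-1 *: \adj (mx n.+1 n.+1 A).
  by rewrite /invmx unitmxE unitfE -detE (introN eqP d0).
rewrite !mxE /minv -[Nat.sub _ _]/(subn _ _) subn1 -pred_Sn (detE n) mx_minor.
by rewrite RdivE RmultE RpowE mulrC /cofactor addnC.
Qed.

Local Open Scope R_scope.
Definition formR n (G : nat -> nat -> R) (c : nat -> R) : R :=
  sumR n (fun i => sumR n (fun j => c i * c j * G i j)).

Definition psdR n (G : nat -> nat -> R) : Prop :=
  (forall i j, (i < n)%coq_nat -> (j < n)%coq_nat -> G i j = G j i) /\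
  forall c, 0 <= formR n G c.

Definition shiftR (s : R) (G : nat -> nat -> R) i j : R := s * idm i j + G i j.

(* Posterior covariance of the points numbered t, t+1, ... given the first t ones,
   with M as covariance matrix of the observations: M = G gives cov and
   M = shiftR (sigma^2) G gives hatcov. *)
Definition schurR t (M G : nat -> nat -> R) a b : R :=
  G (t + a)%coq_nat (t + b)%coq_nat -
  sumR t (fun i => sumR t (fun j =>
    G i (t + a)%coq_nat * minv t M i j * G j (t + b)%coq_nat)).

(* Coefficients, on all t + L kernel sections, of sum_a v_a times the residual of
   the (t + a)-th section after regression on the first t. *)
Definition schur_weight t L (M G : nat -> nat -> R) (v : nat -> R) i : R :=
  if (i <? t)%coq_nat then
    - sumR L (fun a => v a * sumR t (fun j => G (t + a)%coq_nat j * minv t M j i))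
  else v (i - t)%coq_nat.
Local Close Scope R_scope.

Definition rowR n (c : nat -> R) : 'rV[R]_n := \row_i c i.

Lemma formRE n G c : formR n G c = quad (mx n n G) (rowR n c).
Proof.
rewrite quadE /formR sumRE; apply: eq_bigr => i _; rewrite sumRE.
by apply: eq_bigr => j _; rewrite !mxE.
Qed.

Lemma rowR_surj n (v : 'rV[R]_n) : exists c, v = rowR n c.
Proof.
(* Indices from [n] on get the default value 0. *)
exists (fun i => oapp (v 0) 0 (insub i)); apply/rowP => i.
by rewrite mxE valK.
Qed.

Lemma psdR_tr n G : psdR n G -> (mx n n G)^T = mx n n G.
Proof.
move=> [sG _]; apply/matrixP => i j; rewrite !mxE.
by apply: sG; apply/ssrnat.ltP.
Qed.

Lemma psdR_quad n G v : psdR n G -> 0 <= quad (mx n n G) v.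
Proof.
by move=> [_ pG]; have [c ->] := rowR_surj v; rewrite -formRE; apply/RleP.
Qed.

Lemma idmE n (i j : 'I_n) : idm i j = (i == j)%:R.
Proof.
rewrite /idm; case: eqP => [->|ne]; rewrite ?Nat.eqb_refl //.
by case: Nat.eqb_spec => // /val_inj.
Qed.

Lemma mx_shift n s G : mx n n (shiftR s G) = s%:M + mx n n G.
Proof. by apply/matrixP => i j; rewrite !mxE /shiftR RplusE RmultE idmE mulr_natr. Qed.

Lemma det_unitmx n A : det n A <> 0 <-> mx n n A \in unitmx.
Proof. by rewrite unitmxE unitfE -detE; split=> [/eqP|/eqP]. Qed.

Lemma psdR_sub t L G : psdR (t + L) G -> psdR t G.
Proof.
move=> [sG pG]; split=> [i j /ssrnat.ltP it /ssrnat.ltP jt|c].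
  by apply: sG; apply/ssrnat.ltP; rewrite ltn_addr.
(* Extending [c] by 0 beyond [t] does not change the value of the form. *)
have := pG (fun i => if (i < t)%N then c i else 0).
suff -> : formR (t + L) G (fun i => if (i < t)%N then c i else 0) = formR t G c => //.
rewrite /formR !sumRE big_split_ord /= [X in _ + X]big1 ?addr0 => [|i _].
  apply: eq_bigr => i _; rewrite !sumRE big_split_ord /= ltn_ord.
  rewrite [X in _ + X]big1 ?addr0 => [|j _].
    by apply: eq_bigr => j _; rewrite ltn_ord.
  by rewrite ltnNge leq_addr /= !RmultE mulr0 mul0r.
by rewrite sumRE big1 // => j _; rewrite ltnNge leq_addr /= !RmultE !mul0r.
Qed.

Lemma det_shift_neq0 n s G : psdR n G -> 0 < s -> det n (shiftR s G) <> 0.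
Proof.
move=> pG s0; apply/det_unitmx; rewrite mx_shift unitmx_shift // => v.
exact: psdR_quad.
Qed.

(** * Block decomposition into observed and new points, and Schur complements *)

Definition lowR t L (G : nat -> nat -> R) : 'M[R]_(L, t) :=
  mx L t (fun a j => G (t + a)%N j).
Definition brR t L (G : nat -> nat -> R) : 'M[R]_L :=
  mx L L (fun a b => G (t + a)%N (t + b)%N).
Definition uppR t L (G : nat -> nat -> R) : 'M[R]_(t, L) :=
  mx t L (fun j b => G j (t + b)%N).

Lemma mx_block t L G :
  mx (t + L) (t + L) G = block_mx (mx t t G) (uppR t L G) (lowR t L G) (brR t L G).
Proof.
rewrite -[LHS]submxK; congr block_mx; by apply/matrixP => i j; rewrite !mxE.
Qed.

Lemma lowE t L G : psdR (t + L) G -> lowR t L G = (uppR t L G)^T.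
Proof.
move=> [sG _]; apply/matrixP => a j; rewrite !mxE; apply: sG; apply/ssrnat.ltP.
  by rewrite ltn_add2l.
by rewrite ltn_addr.
Qed.

(** [schurR] reads [G i (t + a)] where the block form has [G (t + a) i]; symmetry of [G] identifies
    them. *)
Lemma mx_schur t L M G : psdR (t + L) G -> det t M <> 0 ->
  mx L L (schurR t M G) = brR t L G - lowR t L G *m invmx (mx t t M) *m uppR t L G.
Proof.
move=> pG d0; rewrite lowE //; apply/matrixP => a b; rewrite !mxE /schurR RminusE.
congr (_ - _); rewrite sumRE.
under eq_bigr do rewrite sumRE.
rewrite exchange_big /=; apply: eq_bigr => j _; rewrite !mxE mulr_suml.
by apply: eq_bigr => i _; rewrite !mxE -(minvE _ _ d0).
Qed.

(** Identifies the weights with the vector at which [quad_schur] evaluates the block form. *)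
Lemma schur_weightE t L M G v : det t M <> 0 ->
  rowR (t + L) (schur_weight t L M G v) =
  row_mx (- (rowR L v *m lowR t L G *m invmx (mx t t M))) (rowR L v).
Proof.
move=> d0; apply/rowP => i; rewrite -(splitK i); case: (split i) => j /=.
  rewrite mxE row_mxEl mxE /schur_weight ltbE /= ltn_ord RoppE; congr (- _).
  rewrite sumRE -mulmxA mxE; apply: eq_bigr => a _; rewrite !mxE RmultE.
  congr (_ * _); rewrite sumRE; apply: eq_bigr => b _.
  by rewrite !mxE RmultE -minvE.
rewrite row_mxEr !mxE /schur_weight ltbE /= ltnNge leq_addr /=.
by congr (v _); apply: addKn.
Qed.

(** By [quad_schur] the left side is the form of [G] with s added on the first [t] diagonal entries;
    the added part contributes s times the squared norm of the first [t] weights. Taking s = 0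
    covers the noiseless case. *)
Lemma formR_schur t L s M G v : psdR (t + L) G -> det t M <> 0 ->
  mx t t M = s%:M + mx t t G ->
  formR L (schurR t M G) v =
  formR (t + L) G (schur_weight t L M G v) +
  s * \sum_(i < t) schur_weight t L M G v i ^+ 2.
Proof.
move=> pG d0 hM; rewrite !formRE mx_schur // quad_schur; last exact/det_unitmx.
have -> : block_mx (mx t t M) (uppR t L G) (lowR t L G) (brR t L G) =
  block_mx s%:M 0 0 0 + mx (t + L) (t + L) G.
  by rewrite mx_block add_block_mx hM !add0r.
rewrite -schur_weightE // quadD addrC; congr (_ + _).
rewrite [in LHS]schur_weightE // /quad mul_row_block !mulmx0 !addr0.
rewrite tr_row_mx mul_row_col mul0mx addr0 -/(quad _ _) quad_scalar.
congr (_ * _); apply: eq_bigr => i _; congr (_ ^+ 2).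
have := congr1 (fun r : 'rV_(t + L) => r 0 (lshift L i)) (schur_weightE L G v d0).
by rewrite row_mxEl => <-; rewrite mxE.
Qed.

(** Both summands given by [formR_schur] are nonnegative. *)
Lemma psdR_schur t L s M G : psdR (t + L) G -> det t M <> 0 ->
  mx t t M = s%:M + mx t t G -> 0 <= s -> psdR L (schurR t M G).
Proof.
move=> pG d0 hM s0; split=> [a b /ssrnat.ltP aL /ssrnat.ltP bL|c].
  have : (mx L L (schurR t M G))^T = mx L L (schurR t M G).
    rewrite mx_schur // !lowE // linearB /= !trmx_mul trmxK trmx_inv hM.
    rewrite linearD /= tr_scalar_mx (psdR_tr (psdR_sub pG)) mulmxA; congr (_ - _).
    apply/matrixP => i j; rewrite !mxE; case: pG => sG _.
    by apply: sG; apply/ssrnat.ltP; rewrite ltn_add2l.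
  by move/matrixP/(_ (Ordinal bL) (Ordinal aL)); rewrite !mxE.
apply/RleP; rewrite (formR_schur c pG d0 hM) addr_ge0 //.
  by apply/RleP; case: pG.
by rewrite mulr_ge0 // sumr_ge0 // => i _; rewrite sqr_ge0.
Qed.

(** Adding noise can only lower the form of the inverse, and that form is what is subtracted from
    the prior variance. *)
Lemma schur_diag_le t L s M G a : psdR (t + L) G -> det t G <> 0 ->
  0 < s -> mx t t M = s%:M + mx t t G -> (a < L)%N ->
  schurR t G G a a <= schurR t M G a a.
Proof.
move=> pG d0 s0 hM aL.
have uM : mx t t M \in unitmx.
  by rewrite hM unitmx_shift // => v; apply: psdR_quad; apply: psdR_sub pG.
have dM : det t M <> 0 by apply/det_unitmx.
(* Stated for a general [N] so that it serves for both [G] and [M]. *)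
have E N : det t N <> 0 -> schurR t N G a a =
    brR t L G (Ordinal aL) (Ordinal aL) -
    quad (invmx (mx t t N)) (row (Ordinal aL) (lowR t L G)).
  move=> dN; have := mx_schur pG dN.
  move/matrixP/(_ (Ordinal aL) (Ordinal aL)); rewrite mxE /= => ->.
  rewrite mxE; congr (_ + _); rewrite mxE; congr (- _).
  rewrite /quad -row_mul lowE // tr_row trmxK mxE [RHS]mxE.
  by apply: eq_bigr => j _; rewrite [in RHS]mxE [X in _ = _ * X]mxE.
rewrite !E // lerD2l lerN2 hM quad_invmx_shift ?(ltW s0) //.
- exact/psdR_tr/(psdR_sub pG).
- by move=> v; apply: psdR_quad; apply: psdR_sub pG.
- exact/det_unitmx.
- by rewrite -hM.
Qed.

Local Open Scope R_scope.
(** At c = sigma^-2 this is the matrix whose log-determinant, halved, is the information gain. *)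
Definition infoR (c : R) (G : nat -> nat -> R) i j : R := idm i j + c * G i j.
Local Close Scope R_scope.

Lemma mx_info n c G : mx n n (infoR c G) = 1%:M + c *: mx n n G.
Proof. by apply/matrixP => i j; rewrite !mxE /infoR RplusE RmultE idmE. Qed.

(** Since I + A/s = (s I + A)/s, powers of s factor out equally on both sides. What remains is
    [det_schur] for s I + [G], whose first block is [M] and whose Schur complement is s I +
    [schurR t M G]. *)
Lemma det_info_schur t L s M G : psdR (t + L) G -> s != 0 -> det t M <> 0 ->
  mx t t M = s%:M + mx t t G ->
  det (t + L) (infoR s^-1 G) =
  det t (infoR s^-1 G) * det L (infoR s^-1 (schurR t M G)).
Proof.
move=> pG s0 dM hM; rewrite !detE !mx_info.
have sc n (A : 'M[R]_n) : 1%:M + s^-1 *: A = s^-1 *: (s%:M + A).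
  by rewrite scalerDr -[s%:M]scalemx1 scalerA mulVf // scale1r.
rewrite !sc !detZ exprD mulrACA; congr (_ * _); rewrite mx_block.
have -> : s%:M = block_mx s%:M 0 0 s%:M :> 'M[R]_(t + L).
  exact: scalar_mx_block.
rewrite add_block_mx !add0r -hM det_schur; last exact/det_unitmx.
by rewrite mx_schur // addrA.
Qed.

(** * Concavity of the logarithm and the trace bound *)

Local Open Scope R_scope.

Lemma exp_chord (p y : R) : 0 <= p <= 1 -> exp (p * y) <= 1 + p * (exp y - 1).
Proof.
move=> [p0 p1].
(* Average the tangent bounds at p y for u = 0 and u = y. *)
have t u : exp (p * y) * (1 + (u - p * y)) <= exp u.
  have -> : exp u = exp (p * y) * exp (u - p * y).
    by rewrite -exp_plus; apply: f_equal; ring.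
  by apply: Rmult_le_compat_l; [exact/Rlt_le/exp_pos | exact: exp_ineq1_le].
have t0 := Rmult_le_compat_l (1 - p) _ _ ltac:(lra) (t 0).
have t1 := Rmult_le_compat_l p _ _ p0 (t y).
rewrite exp_0 in t0; nra.
Qed.

(** Concavity of log(1 + x/s) on [0, b]: take logarithms in [exp_chord] with p = l/b and y = log(1 +
    b/s). *)
Lemma ln_chord (l b s : R) : 0 < b -> 0 < s -> 0 <= l <= b ->
  l * ln (1 + b / s) <= b * ln (1 + l / s).
Proof.
move=> b0 s0 [l0 lb].
have ls : 0 <= l / s by apply: Rmult_le_pos; [|exact/Rlt_le/Rinv_0_lt_compat].
have bs : 0 < b / s by apply: Rdiv_lt_0_compat.
have p01 : 0 <= l / b <= 1.
  split; first by apply: Rmult_le_pos; [|exact/Rlt_le/Rinv_0_lt_compat].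
  by apply: (Rmult_le_reg_r b) => //; rewrite /Rdiv Rmult_assoc Rinv_l; lra.
have := exp_chord (ln (1 + b / s)) p01; rewrite exp_ln; last lra.
have -> : 1 + l / b * (1 + b / s - 1) = 1 + l / s by field; lra.
move=> h.
have : ln (exp (l / b * ln (1 + b / s))) <= ln (1 + l / s).
  by case: h => [h|->]; [exact/Rlt_le/ln_increasing/h/exp_pos | exact: Rle_refl].
rewrite ln_exp => /(Rmult_le_compat_l b _ _ (Rlt_le _ _ b0)).
by have -> : b * (l / b * ln (1 + b / s)) = l * ln (1 + b / s) by field; lra.
Qed.

Lemma ln_prod n (f : 'I_n -> R) : (forall i, 0 < f i) ->
  0 < (\prod_i f i)%R /\ ln (\prod_i f i)%R = (\sum_i ln (f i))%R.
Proof.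
elim: n f => [|n IH] f f0.
  by rewrite !big_ord0; split; [exact: Rlt_0_1 | exact: ln_1].
have [p0 e] := IH (fun i => f (lift ord0 i)) (fun i => f0 _).
rewrite !big_ord_recl; split; first exact: Rmult_lt_0_compat.
by rewrite -e; exact: ln_mult.
Qed.

(** [spectral_bounds] puts the eigenvalues in [0, b]; summing [ln_chord] over them bounds the trace
    by the logarithm of the product of the factors 1 + l_i/s. *)
Lemma trace_le_ln n A b s : psdR n A ->
  (forall c, formR n A c <= b * sumR n (fun i => c i ^ 2)) -> 0 < b -> 0 < s ->
  0 < det n (infoR (/ s) A) /\
  0 <= sumR n (fun a => A a a) <= b / ln (1 + b / s) * ln (det n (infoR (/ s) A)).
Proof.
move=> pA bA b0 s0.
have [v|v|l [lb tE dE]] := @spectral_bounds _ n (mx n n A) b (psdR_tr pA).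
- exact: psdR_quad.
- have [c ->] := rowR_surj v; rewrite -formRE; apply/RleP.
  have -> : (\sum_i rowR n c 0 i ^+ 2)%R = sumR n (fun i => c i ^ 2) => //.
  by rewrite sumRE; apply: eq_bigr => i _; rewrite mxE RpowE.
have lb' i : 0 <= l 0%R i <= b by have /andP[/RleP ? /RleP ?] := lb i.
have l1 i : 0 < (1 + / s * l 0 i)%R.
  have := lb' i => -[l0 _].
  have := Rmult_le_pos _ _ (Rlt_le _ _ (Rinv_0_lt_compat _ s0)) l0.
  by rewrite -RplusE -RmultE -R1E; lra.
have [d0 dln] := ln_prod l1.
rewrite detE mx_info dE; split=> //.
have -> : sumR n (fun a => A a a) = (\sum_i l 0 i)%R.
  by rewrite -tE sumRE; apply: eq_bigr => i _; rewrite mxE.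
split; first by apply/RleP/sumr_ge0 => i _; case/andP: (lb i).
have y0 : 0 < ln (1 + b / s).
  rewrite -ln_1; apply: ln_increasing; first lra.
  by have := Rdiv_lt_0_compat _ _ b0 s0; lra.
rewrite dln [X in _ <= X]RmultE mulr_sumr; apply/RleP/ler_sum => i _; apply/RleP.
apply: (Rmult_le_reg_r (ln (1 + b / s))) => //.
change (l 0%R i * ln (1 + b / s) <=
  b / ln (1 + b / s) * ln (1 + / s * l 0%R i) * ln (1 + b / s)).
have -> : b / ln (1 + b / s) * ln (1 + / s * l 0%R i) * ln (1 + b / s) =
  b * ln (1 + l 0%R i / s).
  by rewrite (Rmult_comm (/ s)) -/(Rdiv _ s); field; lra.
exact: ln_chord.
Qed.

(** The case s = 0 of [formR_schur]. For a kernel matrix, the right side is the squared RKHS norm of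
    the combination of sections with these weights. *)
Lemma formR_cov t L G v : psdR (t + L)%coq_nat G -> det t G <> 0 ->
  formR L (schurR t G G) v = formR (t + L)%coq_nat G (schur_weight t L G G v).
Proof.
move=> pG d0; rewrite (@formR_schur t L 0%R G G v pG d0) ?mul0r ?addr0 //.
by apply/matrixP => i j; rewrite !mxE mul0rn add0r.
Qed.

Lemma psdR_hatcov t L s G : psdR (t + L)%coq_nat G -> 0 < s ->
  psdR L (schurR t (shiftR s G) G).
Proof.
move=> pG s0; have /RltP s0' := s0.
apply: (@psdR_schur t L s _ _ pG); last exact: ltW.
  exact: (det_shift_neq0 (psdR_sub pG)).
exact: mx_shift.
Qed.

Lemma cov_diag_le_hatcov t L s G a : psdR (t + L)%coq_nat G -> det t G <> 0 ->
  0 < s -> (a < L)%coq_nat ->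
  schurR t G G a a <= schurR t (shiftR s G) G a a.
Proof.
move=> pG d0 /RltP s0 /ssrnat.ltP aL; apply/RleP.
by apply: (schur_diag_le pG d0 s0) aL; apply: mx_shift.
Qed.

Lemma det_info_hatcov t L s G : psdR (t + L)%coq_nat G -> 0 < s ->
  det (t + L)%coq_nat (infoR (/ s) G) =
  det t (infoR (/ s) G) * det L (infoR (/ s) (schurR t (shiftR s G) G)).
Proof.
move=> pG /RltP s0; apply: (det_info_schur pG); last exact: mx_shift.
  exact: lt0r_neq0.
exact: (det_shift_neq0 (psdR_sub pG)).
Qed.

End KernelMatrix.
Import KernelMatrix.

(** * Finite sums *)

Lemma sumR_ext n F G : (forall i, (i < n)%nat -> F i = G i) -> sumR n F = sumR n G.
Proof.
  induction n as [|n IH]; intros H; simpl; trivial.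
  rewrite IH, H; auto.
Qed.

Lemma sumR_plus n F G : sumR n (fun i => F i + G i) = sumR n F + sumR n G.
Proof. induction n; simpl; lra. Qed.

Lemma sumR_scal n c F : sumR n (fun i => c * F i) = c * sumR n F.
Proof. induction n; simpl; [|rewrite IHn]; ring. Qed.

Lemma sumR_const n c : sumR n (fun _ => c) = INR n * c.
Proof. induction n; [simpl; ring|]. rewrite S_INR; simpl sumR; rewrite IHn; ring. Qed.

Lemma sumR_le n F G :
  (forall i, (i < n)%nat -> F i <= G i) -> sumR n F <= sumR n G.
Proof.
  induction n as [|n IH]; intros H; simpl; [lra|].
  apply Rplus_le_compat; auto.
Qed.

Lemma sumR_add a b F : sumR (a + b) F = sumR a F + sumR b (fun i => F (a + i)%nat).
Proof.
  induction b as [|b IH]; simpl; [rewrite Nat.add_0_r; ring|].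
  rewrite Nat.add_succ_r; simpl; rewrite IH; ring.
Qed.

Lemma sumR_mul N L F :
  sumR (N * L) F = sumR N (fun n => sumR L (fun i => F (n * L + i)%nat)).
Proof.
  induction N as [|N IH]; trivial.
  replace (S N * L)%nat with (N * L + L)%nat by lia.
  rewrite sumR_add, IH; reflexivity.
Qed.

Lemma sumR_swap m n F :
  sumR m (fun i => sumR n (F i)) = sumR n (fun j => sumR m (fun i => F i j)).
Proof.
  induction m as [|m IH]; simpl.
  - rewrite sumR_const; ring.
  - rewrite IH, <- sumR_plus; reflexivity.
Qed.

Lemma sumR_add2 a b (F : nat -> nat -> R) :
  sumR (a + b) (fun i => sumR (a + b) (F i)) =
  sumR a (fun i => sumR a (F i)) +
  sumR a (fun i => sumR b (fun j => F i (a + j)%nat)) +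
  sumR b (fun i => sumR a (F (a + i)%nat)) +
  sumR b (fun i => sumR b (fun j => F (a + i)%nat (a + j)%nat)).
Proof.
  rewrite sumR_add.
  rewrite (sumR_ext a (fun i => sumR (a + b) (F i))
    (fun i => sumR a (F i) + sumR b (fun j => F i (a + j)%nat)))
    by (intros; apply sumR_add).
  rewrite (sumR_ext b (fun i => sumR (a + b) (F (a + i)%nat))
    (fun i => sumR a (F (a + i)%nat) + sumR b (fun j => F (a + i)%nat (a + j)%nat)))
    by (intros; apply sumR_add).
  rewrite !sumR_plus; ring.
Qed.

(** The discriminant argument behind Cauchy-Schwarz, used for Euclidean vectors and for the kernel
    form. The latter may be degenerate, hence the case q = 0. *)
Lemma quadratic_nonneg_bound a e q :
  0 <= q -> (forall t, 0 <= a + 2 * t * e + t ^ 2 * q) -> e <= sqrt a * sqrt q.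
Proof.
  intros q0 H.
  assert (a0 : 0 <= a) by (specialize (H 0); lra).
  rewrite <- sqrt_mult by assumption.
  apply Rle_trans with (Rabs e); [apply Rle_abs|].
  rewrite <- sqrt_Rsqr_abs; apply sqrt_le_1_alt; unfold Rsqr.
  destruct (Req_dec q 0) as [->|qn].
  - destruct (Req_dec e 0) as [->|en]; [lra|].
    (* With q = 0 the expression is affine in t; this t gives it the value -1. *)
    specialize (H (- (a + 1) / (2 * e))).
    replace (a + 2 * (- (a + 1) / (2 * e)) * e + (- (a + 1) / (2 * e)) ^ 2 * 0)
      with (-1) in H by (field; assumption).
    lra.
  (* The minimiser of the quadratic. *)
  - specialize (H (- e / q)).
    replace (a + 2 * (- e / q) * e + (- e / q) ^ 2 * q) with ((a * q - e * e) / q)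
      in H by (field; assumption).
    apply (Rmult_le_compat_r q) in H; [|assumption].
    unfold Rdiv in H; rewrite Rmult_assoc, Rinv_l in H; lra.
Qed.

Lemma sumR_cauchy_schwarz n u v :
  sumR n (fun i => u i * v i) <=
  sqrt (sumR n (fun i => u i ^ 2)) * sqrt (sumR n (fun i => v i ^ 2)).
Proof.
  apply quadratic_nonneg_bound.
  - induction n; simpl; [lra|]. pose proof (pow2_ge_0 (v n)); simpl in *; lra.
  - intros t.
    replace (_ + _ + _) with (sumR n (fun i => (u i + t * v i) ^ 2)).
    + induction n; simpl; [lra|].
      pose proof (pow2_ge_0 (u n + t * v n)); simpl in *; lra.
    + induction n; cbn [sumR]; [ring|]. rewrite IHn; ring.
Qed.

(** Cauchy-Schwarz gives c^T A c <= |c| |A c|, and |A c| <= s |c| follows by rescaling a nonzero [c]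
    to unit length. *)
Lemma spec_norm_form n A s c :
  is_spec_norm n A s -> formR n A c <= s * sumR n (fun i => c i ^ 2).
Proof.
  intros [ub _].
  set (q := sumR n (fun i => c i ^ 2)).
  assert (q0 : 0 <= q).
  { unfold q; clear; induction n; simpl; [lra|].
    pose proof (pow2_ge_0 (c n)); simpl in *; lra. }
  assert (E : formR n A c <= sqrt q * vnorm n (matvec n A c)).
  { unfold formR; rewrite (sumR_ext n _ (fun i => c i * matvec n A c i)).
    - apply sumR_cauchy_schwarz.
    - intros i _; unfold matvec; rewrite <- sumR_scal; apply sumR_ext; intros; ring. }
  apply (Rle_trans _ _ _ E).
  destruct (Req_dec q 0) as [->|qn]; [rewrite sqrt_0; lra|].
  assert (sq : 0 < sqrt q) by (apply sqrt_lt_R0; lra).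
  assert (N : vnorm n (matvec n A (fun i => / sqrt q * c i)) <= s).
  { apply ub; exists (fun i => / sqrt q * c i); split; trivial.
    unfold vnorm; rewrite (sumR_ext n _ (fun i => (/ sqrt q) ^ 2 * c i ^ 2))
      by (intros; ring).
    rewrite sumR_scal; fold q; rewrite pow_inv, pow2_sqrt, Rinv_l, sqrt_1 by assumption.
    reflexivity. }
  assert (M : vnorm n (matvec n A (fun i => / sqrt q * c i)) =
              / sqrt q * vnorm n (matvec n A c)).
  { unfold vnorm.
    rewrite (sumR_ext n _ (fun i => (/ sqrt q) ^ 2 * matvec n A c i ^ 2)).
    - rewrite sumR_scal, sqrt_mult_alt by apply pow2_ge_0.
      rewrite sqrt_pow2; trivial. left; apply Rinv_0_lt_compat, sq.
    - intros i _; unfold matvec.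
      rewrite (sumR_ext n _ (fun j => / sqrt q * (A i j * c j))) by (intros; ring).
      rewrite sumR_scal; ring. }
  rewrite M in N.
  apply (Rmult_le_compat_l (sqrt q * sqrt q)) in N; [|nra].
  replace (sqrt q * sqrt q * (/ sqrt q * vnorm n (matvec n A c)))
    with (sqrt q * vnorm n (matvec n A c)) in N by (field; lra).
  rewrite sqrt_sqrt in N by assumption; lra.
Qed.

(** Matrices are functions on all pairs of naturals, so exchanging point sequences that agree only
    on an initial segment goes through this lemma. *)
Lemma det_ext n A C :
  (forall i j, (i < n)%nat -> (j < n)%nat -> A i j = C i j) -> det n A = det n C.
Proof.
  revert A C; induction n as [|n IH]; intros A C H; trivial.
  cbn [det]; apply sumR_ext; intros j hj.
  rewrite (H O j) by lia; f_equal.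
  apply IH; intros a b ha hb; unfold minor.
  apply H; [destruct (a <? 0)%nat|destruct (b <? j)%nat]; lia.
Qed.

Lemma minv_ext n A C i j :
  (forall i j, (i < n)%nat -> (j < n)%nat -> A i j = C i j) ->
  minv n A i j = minv n C i j.
Proof.
  intros H; unfold minv; rewrite (det_ext n A C H).
  rewrite (det_ext (n - 1) (minor A j i) (minor C j i)); trivial.
  intros a b ha hb; unfold minor.
  apply H; [destruct (a <? j)%nat|destruct (b <? i)%nat]; lia.
Qed.

(** * The posterior mean in the reproducing kernel Hilbert space *)

(** Joins observed points and a candidate batch into one sequence, so that a single Gram matrix
    carries all the kernel values. *)
Definition app_seq {T : Type} (t : nat) (u v : nat -> T) (i : nat) : T :=
  if (i <? t)%nat then u i else v (i - t)%nat.

Lemma app_seq_l {T} t (u v : nat -> T) i : (i < t)%nat -> app_seq t u v i = u i.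
Proof. intros H; unfold app_seq; apply Nat.ltb_lt in H; rewrite H; trivial. Qed.

Lemma app_seq_r {T} t (u v : nat -> T) i : app_seq t u v (t + i)%nat = v i.
Proof.
  unfold app_seq; destruct (Nat.ltb_spec (t + i) t); [lia|].
  f_equal; lia.
Qed.

Lemma app_seq_in {T} (X : T -> Prop) t n u v :
  (forall i, (i < t)%nat -> X (u i)) -> (forall i, (i < n)%nat -> X (v i)) ->
  forall i, (i < t + n)%nat -> X (app_seq t u v i).
Proof.
  intros Hu Hv i Hi; unfold app_seq; destruct (Nat.ltb_spec i t); auto.
  apply Hv; lia.
Qed.

Section Rkhs.
Context {d : nat} (X : Rd d -> Prop) (k : Rd d -> Rd d -> R).
Hypothesis Hk : pd_kernel X k.

Lemma psdR_Kmat n p : (forall i, (i < n)%nat -> X (p i)) -> psdR n (Kmat k p).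
Proof.
  destruct Hk as [ks kp]; intros Hp; split.
  - intros i j hi hj; apply ks; auto.
  - intros c; apply kp; assumption.
Qed.

(** Cauchy-Schwarz for [h] and the sum of c_j k(p_j, .), by the reproducing property: the squared
    norm of [h] plus t times that sum is nonnegative for every t. *)
Lemma h0_eval_bound (h : H0 d) n c p :
  (forall i, (i < h_n h)%nat -> X (h_p h i)) -> (forall i, (i < n)%nat -> X (p i)) ->
  sumR n (fun j => c j * h0_eval k h (p j)) <=
  h0_norm k h * sqrt (formR n (Kmat k p) c).
Proof.
  intros Hh Hp.
  apply quadratic_nonneg_bound; [apply psdR_Kmat; assumption|].
  intros t.
  set (C := app_seq (h_n h) (h_c h) (fun i => t * c i)).
  set (P := app_seq (h_n h) (h_p h) p).
  set (F := fun i j => C i * C j * k (P i) (P j)).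
  (* This squared norm is the kernel form on the concatenated points; its four blocks give the
     coefficients of the quadratic in t. *)
  assert (F0 : 0 <= sumR (h_n h + n) (fun i => sumR (h_n h + n) (F i)))
    by (apply (proj2 Hk), (app_seq_in X); assumption).
  rewrite sumR_add2 in F0.
  set (e := sumR n (fun j => c j * h0_eval k h (p j))).
  assert (F1 : sumR (h_n h) (fun i => sumR (h_n h) (F i)) =
    sumR (h_n h) (fun i => sumR (h_n h) (fun j =>
      h_c h i * h_c h j * k (h_p h i) (h_p h j)))).
  { apply sumR_ext; intros i Hi; apply sumR_ext; intros j Hj.
    unfold F, C, P; rewrite !app_seq_l by assumption; reflexivity. }
  assert (F2 : sumR (h_n h) (fun i => sumR n (fun j => F i (h_n h + j)%nat)) = t * e).
  { rewrite sumR_swap; unfold e; rewrite <- sumR_scal; apply sumR_ext; intros j Hj.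
    unfold h0_eval; rewrite <- !sumR_scal; apply sumR_ext; intros i Hi.
    unfold F, C, P; rewrite !app_seq_r, !app_seq_l by assumption; ring. }
  assert (F3 : sumR n (fun i => sumR (h_n h) (F (h_n h + i)%nat)) = t * e).
  { unfold e; rewrite <- sumR_scal; apply sumR_ext; intros j Hj.
    unfold h0_eval; rewrite <- !sumR_scal; apply sumR_ext; intros i Hi.
    unfold F, C, P; rewrite !app_seq_r, !app_seq_l by assumption.
    rewrite (proj1 Hk (p j) (h_p h i)) by auto; ring. }
  assert (F4 : sumR n (fun i => sumR n (fun j => F (h_n h + i)%nat (h_n h + j)%nat)) =
    t ^ 2 * formR n (Kmat k p) c).
  { unfold formR; rewrite <- sumR_scal; apply sumR_ext; intros i Hi.
    rewrite <- sumR_scal; apply sumR_ext; intros j Hj.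
    unfold F, C, P; rewrite !app_seq_r; unfold Kmat; ring. }
  rewrite F1, F2, F3, F4 in F0; lra.
Qed.

Lemma sumR_cv n (u : nat -> nat -> R) l :
  (forall i, (i < n)%nat -> Un_cv (fun m => u m i) (l i)) ->
  Un_cv (fun m => sumR n (u m)) (sumR n l).
Proof.
  induction n as [|n IH]; intros H; simpl.
  - intros e He; exists O; intros; rewrite Rdist_eq; assumption.
  - apply CV_plus; auto.
Qed.

Lemma cst_cv c : Un_cv (fun _ => c) c.
Proof. intros e He; exists O; intros; rewrite Rdist_eq; assumption. Qed.

Context (f : Rd d -> R) (g : nat -> H0 d) (B : R).
Hypothesis Hf : rkhs_limit X k f g B.

Lemma rkhs_norm_ge0 : 0 <= B.
Proof.
  destruct Hf as (_ & _ & _ & HB).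
  apply (@Rle_cv_lim (fun _ => 0) (fun n => h0_norm k (g n)) 0 B);
    [intros; apply sqrt_pos|apply cst_cv|exact HB].
Qed.

(** The limit of [h0_eval_bound] along the sequence [g]. *)
Lemma rkhs_eval_bound n c p : (forall i, (i < n)%nat -> X (p i)) ->
  sumR n (fun j => c j * f (p j)) <= B * sqrt (formR n (Kmat k p) c).
Proof.
  intros Hp; destruct Hf as (Hg & _ & Hev & HB).
  apply (@Rle_cv_lim (fun m => sumR n (fun j => c j * h0_eval k (g m) (p j)))
    (fun m => h0_norm k (g m) * sqrt (formR n (Kmat k p) c))).
  - intros m; apply h0_eval_bound; auto.
  - apply sumR_cv; intros i Hi; apply CV_mult; [apply cst_cv|auto].
  - apply CV_mult; [exact HB|apply cst_cv].
Qed.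

(** The left side is a combination of values of [f] at observed and new points with the Schur
    weights, and by [formR_cov] the kernel form at these weights is that of [cov]. *)
Lemma post_mean_gap t L x Z v :
  (forall i, (i < t)%nat -> X (x i)) -> (forall i, (i < L)%nat -> X (Z i)) ->
  det t (Kmat k x) <> 0 ->
  sumR L (fun a => v a * (f (Z a) - post_mean k x f t (Z a))) <=
  B * sqrt (formR L (cov k x t Z) v).
Proof.
  intros Hx HZ Hd.
  set (p := app_seq t x Z).
  assert (Hp : forall i, (i < t + L)%nat -> X (p i)) by (apply app_seq_in; auto).
  set (G := Kmat k p).
  assert (EG : forall i j, (i < t)%nat -> (j < t)%nat -> G i j = Kmat k x i j).
  { intros i j Hi Hj; unfold G, Kmat, p; rewrite !app_seq_l; auto. }
  assert (HdG : det t G <> 0) by (rewrite (det_ext t G _ EG); exact Hd).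
  assert (EC : formR L (cov k x t Z) v = formR L (schurR t G G) v).
  { unfold formR; apply sumR_ext; intros a Ha; apply sumR_ext; intros b Hb; f_equal.
    unfold cov, schurR; apply (f_equal2 Rminus).
    - unfold G, Kmat, p; rewrite !app_seq_r; reflexivity.
    - apply sumR_ext; intros i Hi; apply sumR_ext; intros j Hj.
      rewrite (minv_ext t G _ i j EG); f_equal; [f_equal|];
        unfold G, Kmat, p; rewrite app_seq_l, app_seq_r by assumption; trivial. }
  rewrite EC.
  rewrite formR_cov by (auto; apply psdR_Kmat; exact Hp).
  set (w := schur_weight t L G G v).
  eapply Rle_trans; [|apply (rkhs_eval_bound (t + L) w p Hp)].
  apply Req_le; rewrite sumR_add.
  assert (W2 : sumR L (fun a => w (t + a)%nat * f (p (t + a)%nat)) =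
    sumR L (fun a => v a * f (Z a))).
  { apply sumR_ext; intros a Ha; unfold p; rewrite app_seq_r; f_equal.
    unfold w, schur_weight; destruct (Nat.ltb_spec (t + a) t); [lia|f_equal; lia]. }
  rewrite W2.
  rewrite (sumR_ext L _ (fun a => v a * f (Z a) + (-1) * (v a * post_mean k x f t (Z a))))
    by (intros; ring).
  rewrite sumR_plus, sumR_scal, Rplus_comm; f_equal.
  (* The weights on the observed points reproduce minus the weighted posterior means. *)
  rewrite (sumR_ext t (fun i => w i * f (p i)) (fun i => sumR L (fun a => (-1) *
     (v a * sumR t (fun j => k (Z a) (x j) * minv t (Kmat k x) j i * f (x i)))))).
  - rewrite sumR_swap, <- sumR_scal; apply sumR_ext; intros a Ha.
    rewrite !sumR_scal; unfold post_mean; rewrite sumR_swap; reflexivity.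
  - intros i Hi; unfold w, schur_weight.
    destruct (Nat.ltb_spec i t); [|lia].
    rewrite sumR_scal; unfold p; rewrite app_seq_l by assumption.
    rewrite Ropp_mult_distr_l_reverse, Rmult_comm, <- sumR_scal.
    rewrite <- (Rmult_1_l (sumR L _)), Ropp_mult_distr_l; f_equal.
    apply sumR_ext; intros a Ha.
    rewrite <- Rmult_assoc, (Rmult_comm (f _)), Rmult_assoc, <- sumR_scal; f_equal.
    apply sumR_ext; intros j Hj.
    rewrite (minv_ext t G _ j i EG).
    unfold G, Kmat at 1, p; rewrite app_seq_r, app_seq_l by assumption; ring.
Qed.
End Rkhs.

(** * Regret *)

Lemma maxR_ge n s i : (i <= n)%nat -> s i <= maxR n s.
Proof.
  induction n as [|n IH]; intros Hi; simpl.
  - replace i with O by lia; lra.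
  - destruct (Nat.eq_dec i (S n)) as [->|]; [apply Rmax_r|].
    eapply Rle_trans; [apply IH; lia|apply Rmax_l].
Qed.

Lemma formR_1 C : formR 1 C (fun _ => 1) = C O O.
Proof. unfold formR; simpl; ring. Qed.

Lemma sqrt_div_mul_self y c : 0 < y -> y * sqrt (c / y) = sqrt y * sqrt c.
Proof.
  intros Hy; rewrite <- (sqrt_sqrt y) at 1 by lra.
  rewrite Rmult_assoc, <- (sqrt_mult_alt y) by lra.
  do 2 f_equal; field; lra.
Qed.

Lemma batch_regret {d} (X : Rd d -> Prop) k f g B L n x xstar :
  pd_kernel X k -> rkhs_limit X k f g B -> (1 <= L)%nat ->
  (forall t, (t < n * L + L)%nat -> X (x t)) -> det (n * L) (Kmat k x) <> 0 ->
  (forall Z, (forall i, (i < L)%nat -> X (Z i)) ->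
     acq k f x B L n Z <= acq k f x B L n (fun i => x (n * L + i)%nat)) ->
  X xstar ->
  sumR L (fun i => f xstar - f (x (n * L + i)%nat)) <=
  2 * B * sqrt (INR L) *
    sqrt (sumR L (fun a => cov k x (n * L) (fun i => x (n * L + i)%nat) a a)).
Proof.
  intros Hk Hf HL Hx Hd Hmax Hs.
  assert (L0 : 0 < INR L) by (apply lt_0_INR; lia).
  assert (Hx' : forall i, (i < n * L)%nat -> X (x i)) by (intros; apply Hx; lia).
  set (Z := fun i => x (n * L + i)%nat).
  set (C := cov k x (n * L) Z).
  set (m := post_mean k x f (n * L)).
  set (V := cov k x (n * L) (fun _ => xstar) O O).
  (* [post_mean_gap] for the one-point batch with weight 1. *)
  assert (U : f xstar - m xstar <= B * sqrt V).
  { pose proof (post_mean_gap X k Hk f g B Hf (n * L) 1 x (fun _ => xstar)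
      (fun _ => 1) Hx' (fun _ _ => Hs) Hd) as H.
    rewrite formR_1 in H; simpl sumR in H; fold m in H; fold V in H; lra. }
  (* Here the weights are -1/L: the negative sign bounds the mean minus [f], matching the subtracted
     root in [acq]. *)
  assert (W : sumR L (fun a => m (Z a)) - sumR L (fun a => f (Z a)) <=
    INR L * (B * sqrt (sumR L (fun a => sumR L (fun b => C a b)) / INR L ^ 2))).
  { pose proof (post_mean_gap X k Hk f g B Hf (n * L) L x Z
      (fun _ => - / INR L) Hx' (fun i Hi => Hx _ (proj1 (Nat.add_lt_mono_l _ _ _) Hi)) Hd)
      as H.
    replace (formR L (cov k x (n * L) Z) (fun _ => - / INR L))
      with (sumR L (fun a => sumR L (fun b => C a b)) / INR L ^ 2) in H.
    - rewrite sumR_scal in H; fold m in H.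
      rewrite (sumR_ext L _ (fun a => f (Z a) + (-1) * m (Z a))) in H by (intros; ring).
      rewrite sumR_plus, sumR_scal in H.
      apply (Rmult_le_compat_l (INR L)) in H; [|lra].
      eapply Rle_trans; [|exact H].
      apply Req_le; field; lra.
    - fold C; unfold formR, Rdiv; rewrite Rmult_comm, <- sumR_scal.
      apply sumR_ext; intros a _; rewrite <- sumR_scal.
      apply sumR_ext; intros b _; field; lra. }
  (* On the constant batch every covariance entry is [V], so both roots are sqrt V and the
     coefficients 2 and -1 leave the upper confidence bound of [U]. *)
  specialize (Hmax (fun _ => xstar) (fun _ _ => Hs)).
  unfold acq in Hmax; fold Z m C in Hmax.
  change (cov k x (n * L) (fun _ => xstar)) with (fun _ _ : nat => V) in Hmax.
  cbv beta zeta in Hmax.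
  rewrite (sumR_ext L (fun _ => sumR L (fun _ => V)) (fun _ => INR L * V)) in Hmax
    by (intros; apply sumR_const).
  rewrite !sumR_const in Hmax.
  replace (INR L * V / INR L) with V in Hmax by (field; lra).
  replace (INR L * (INR L * V) / INR L ^ 2) with V in Hmax by (field; lra).
  set (D := sqrt (sumR L (fun a => sumR L (fun b => C a b)) / INR L ^ 2)) in *.
  replace (/ INR L * (INR L * m xstar)) with (m xstar) in Hmax by (field; lra).
  rewrite (sumR_ext L _ (fun i => f xstar + (-1) * f (Z i))) by (intros; unfold Z; ring).
  rewrite sumR_plus, sumR_scal, sumR_const.
  rewrite Rmult_assoc, <- sqrt_div_mul_self by assumption.
  set (E := sqrt (sumR L (fun a => C a a) / INR L)) in *.
  assert (Hm : f xstar <= / INR L * sumR L (fun i => m (Z i)) + B * (2 * E - D)).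
  { change (sumR L (fun i => m (x (n * L + i)%nat)))
      with (sumR L (fun i => m (Z i))) in Hmax; lra. }
  (* After scaling by L, the term in [D] cancels against the one in [W]. *)
  apply (Rmult_le_compat_l (INR L)) in Hm; [|lra].
  rewrite Rmult_plus_distr_l, <- Rmult_assoc, Rinv_r, Rmult_1_l in Hm by lra.
  lra.
Qed.

(** Induction on batches: [det_info_hatcov] splits off one determinant factor and [trace_le_ln] pays
    for its trace. Positivity of the determinants is carried along so that the logarithm of the
    product splits. *)
Lemma trace_hatcov_sum_le {d} (X : Rd d -> Prop) k L x s2 beta N :
  pd_kernel X k -> (forall t, (t < N * L)%nat -> X (x t)) -> 0 < s2 -> 0 < beta ->
  (forall n c, (n < N)%nat ->
     formR L (hatcov k x s2 (n * L) (fun i => x (n * L + i)%nat)) c <=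
     beta * sumR L (fun i => c i ^ 2)) ->
  (forall n, (n < N)%nat ->
     0 <= sumR L (fun a => hatcov k x s2 (n * L) (fun i => x (n * L + i)%nat) a a)) /\
  0 < det (N * L) (infoR (/ s2) (Kmat k x)) /\
  sumR N (fun n => sumR L (fun a =>
    hatcov k x s2 (n * L) (fun i => x (n * L + i)%nat) a a)) <=
  beta / ln (1 + beta / s2) * ln (det (N * L) (infoR (/ s2) (Kmat k x))).
Proof.
  intros Hk Hx Hs Hb; induction N as [|N IH]; intros Hq.
  - split; [lia|]; simpl; rewrite ln_1; lra.
  - destruct IH as (P & D & Q); [intros; apply Hx; lia|intros; apply Hq; lia|].
    assert (E : (S N * L)%nat = (N * L + L)%nat) by lia.
    assert (G : psdR (N * L + L) (Kmat k x)).
    { apply (psdR_Kmat X); trivial; intros; apply Hx; lia. }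
    set (H := fun n => hatcov k x s2 (n * L) (fun i => x (n * L + i)%nat)).
    destruct (@trace_le_ln L (H N) beta s2) as (D' & P' & Q'); trivial.
    { exact (@psdR_hatcov (N * L) L s2 (Kmat k x) G Hs). }
    { intros c; apply Hq; lia. }
    rewrite E, (@det_info_hatcov (N * L) L s2 (Kmat k x) G Hs).
    (* The batch continues the same sequence [x], so the two matrices agree by conversion. *)
    change (schurR (N * L) (shiftR s2 (Kmat k x)) (Kmat k x)) with (H N).
    split; [|split].
    + intros n Hn; destruct (Nat.eq_dec n N) as [->|]; [exact P'|apply P; lia].
    + apply Rmult_lt_0_compat; assumption.
    + rewrite ln_mult by assumption; simpl; fold (H N).
      rewrite Rmult_plus_distr_l; apply Rplus_le_compat; assumption.
Qed.

Theorem theorem2 (d : nat) (X : Rd d -> Prop) (k : Rd d -> Rd d -> R)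
  (f : Rd d -> R) (g : nat -> H0 d) (B : R) (N L : nat) (x : nat -> Rd d)
  (sigma beta gam : R) (s : nat -> R) (xstar : Rd d) :
  compact_Rd X -> pd_kernel X k -> (forall z, X z -> k z z <= 1) ->
  rkhs_limit X k f g B ->
  (1 <= N)%nat -> (1 <= L)%nat ->
  (forall t, (t < N * L)%nat -> X (x t)) ->
  (forall t, (t <= N * L)%nat -> det t (Kmat k x) <> 0) ->
  (forall n, (n < N)%nat -> forall Z : nat -> Rd d,
      (forall i, (i < L)%nat -> X (Z i)) ->
      acq k f x B L n Z <= acq k f x B L n (fun i => x (n * L + i)%nat)) ->
  X xstar -> (forall y, X y -> f y <= f xstar) ->
  0 < sigma ->
  (forall n, (n < N)%nat ->
      is_spec_norm L (hatcov k x (sigma ^ 2) (n * L) (fun i => x (n * L + i)%nat)) (s n)) ->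
  beta = maxR (N - 1) s -> 0 < beta ->
  is_lub (gamma_set X k sigma (N * L)) gam ->
  let T := (N * L)%nat in
  let C2 := 8 * beta / ln (1 + beta / sigma ^ 2) in
  sumR T (fun t => f xstar - f (x t)) <= B * sqrt (INR T * C2 * gam) /\
  f xstar - maxR (T - 1) (fun t => f (x t)) <= B * sqrt (C2 * gam / INR T).
Proof.
  intros _ Hk _ Hf HN HL Hx Hd Hacq Hs _ Hsig Hspec Hbeta Hb Hgam T C2.
  pose proof (rkhs_norm_ge0 X k f g B Hf) as HB.
  assert (Hs2 : 0 < sigma ^ 2) by (apply pow_lt; assumption).
  assert (NL : forall n, (n < N)%nat -> (n * L + L <= N * L)%nat) by (intros; nia).
  set (H := fun n => hatcov k x (sigma ^ 2) (n * L) (fun i => x (n * L + i)%nat)).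
  set (h := fun n => sumR L (fun a => H n a a)).
  set (kap := beta / ln (1 + beta / sigma ^ 2)).
  assert (Y0 : 0 < kap).
  { apply Rdiv_lt_0_compat; trivial; rewrite <- ln_1; apply ln_increasing; [lra|].
    pose proof (Rdiv_lt_0_compat _ _ Hb Hs2); lra. }
  assert (Hq : forall n c, (n < N)%nat ->
    formR L (H n) c <= beta * sumR L (fun i => c i ^ 2)).
  { intros n c Hn; eapply Rle_trans; [apply (spec_norm_form _ _ _ _ (Hspec n Hn))|].
    apply Rmult_le_compat_r.
    - clear; induction L as [|n0]; simpl; [lra|].
      pose proof (pow2_ge_0 (c n0)); simpl in *; lra.
    (* [maxR (N - 1)] ranges over the indices 0 to N - 1 inclusive. *)
    - rewrite Hbeta; apply maxR_ge; lia. }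
  destruct (trace_hatcov_sum_le X k L x (sigma ^ 2) beta N Hk Hx Hs2 Hb Hq)
    as (h0 & _ & hsum).
  (* The factor 2 undoes the one half in the information gain. *)
  assert (hg : sumR N h <= kap * (2 * gam)).
  { eapply Rle_trans; [exact hsum|]; fold kap.
    apply Rmult_le_compat_l; [lra|].
    assert (G : / 2 * ln (det (N * L) (infoR (/ sigma ^ 2) (Kmat k x))) <= gam).
    { apply (proj1 Hgam); exists x; split; [exact Hx|reflexivity]. }
    lra. }
  assert (HR : sumR T (fun t => f xstar - f (x t)) <= B * sqrt (INR T * C2 * gam)).
  { unfold T at 1; rewrite sumR_mul.
    (* The factor 1 prepares Cauchy-Schwarz against the constant sequence 1 over the batches. *)
    eapply Rle_trans;
      [apply (sumR_le N _ (fun n => 2 * B * sqrt (INR L) * (1 * sqrt (h n))))|].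
    - intros n Hn; pose proof (NL n Hn).
      eapply Rle_trans;
        [apply (batch_regret X k f g B L n x xstar); auto; [intros; apply Hx|apply Hd]; lia|].
      rewrite Rmult_1_l; apply Rmult_le_compat_l.
      + apply Rmult_le_pos; [lra|apply sqrt_pos].
      + apply sqrt_le_1_alt, sumR_le; intros a Ha.
        apply (@cov_diag_le_hatcov (n * L) L (sigma ^ 2) (Kmat k x) a); trivial.
        * apply (psdR_Kmat X); trivial; intros; apply Hx; lia.
        * apply Hd; lia.
    - rewrite sumR_scal.
      apply Rle_trans with
        (2 * B * sqrt (INR L) * (sqrt (INR N) * sqrt (kap * (2 * gam)))).
      + apply Rmult_le_compat_l; [apply Rmult_le_pos; [lra|apply sqrt_pos]|].
        eapply Rle_trans; [apply (sumR_cauchy_schwarz N (fun _ => 1))|].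
        rewrite sumR_const, pow1, Rmult_1_r.
        apply Rmult_le_compat_l; [apply sqrt_pos|].
        apply sqrt_le_1_alt; rewrite (sumR_ext N _ h); trivial.
        intros n Hn; apply pow2_sqrt; exact (h0 n Hn).
      + apply Req_le.
        (* The 8 in [C2] is 2^2 from the batch bound times 2 from the information gain. *)
        replace (INR T * C2 * gam) with (2 ^ 2 * (INR L * (INR N * (kap * (2 * gam))))).
        * rewrite !sqrt_mult_alt, sqrt_pow2 by (try apply pos_INR; lra); ring.
        * unfold T, C2; rewrite mult_INR; unfold kap, Rdiv; ring. }
  split; [exact HR|].
  assert (T1 : (1 <= T)%nat) by (unfold T; nia).
  assert (T0 : 0 < INR T) by (apply lt_0_INR; lia).
  (* T times the simple regret is at most the cumulative regret, since the best value dominates each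
     observed one. *)
  apply (Rmult_le_reg_l (INR T)); trivial.
  rewrite (Rmult_comm B), <- Rmult_assoc, sqrt_div_mul_self, <- sqrt_mult_alt by lra.
  rewrite <- Rmult_assoc, (Rmult_comm _ B).
  eapply Rle_trans; [|exact HR].
  rewrite <- sumR_const; apply sumR_le; intros t Ht.
  pose proof (maxR_ge (T - 1) (fun t => f (x t)) t ltac:(lia)); simpl in *; lra.
Qed.
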